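(* Let $A\in\mathbb{H}^{m\times n}$ have rank $\nu$, and let $W_2\in\mathbb{H}^{n\times m}$ be a matrix such that $\dim(\mathcal{R}_l(W_2))=t\le\nu$ and $\dim(\mathcal{N}_l(W_2))=n-t$. Let $W_2=T_2S_2$ be a full rank factorization of $W_2$. If $A$ has a $\{2\}$-inverse $A^{(2)}_{l,(W_2,W_2)}$, then: (a) $S_2AT_2$ is an invertible matrix. (b) With $X=T_2(S_2AT_2)^{-1}S_2$, one has $A^{(2)}_{l,(W_2,W_2)}=X=A^{(2)}_{l,(S_2,T_2)}$.
   Context: $\mathbb{H}$ denotes the real quaternions. For $B\in\mathbb{H}^{m\times n}$, $\mathcal{R}_l(B)=\{xB : x\in\mathbb{H}^{1\times m}\}$ and $\mathcal{N}_l(B)=\{x\in\mathbb{H}^{1\times m} : xB=0\}$ are the left range and left null space, and dimensions are dimensions of left quaternion vector spaces. The rank of $B$ is the maximal number of right linearly independent columns (equivalently, of left linearly independent rows). A full rank factorization of $W_2\in\mathbb{H}^{n\times m}$ of rank $t$ is a factorization $W_2=T_2S_2$ with $T_2\in\mathbb{H}^{n\times t}$, $S_2\in\mathbb{H}^{t\times m}$ and $\operatorname{rank}(T_2)=\operatorname{rank}(S_2)=t$. For $A\in\mathbb{H}^{m\times n}$, $A^{(2)}_{l,(S,T)}$ denotes the matrix $X\in\mathbb{H}^{n\times m}$ with $XAX=X$, $\mathcal{R}_l(X)=\mathcal{R}_l(S)$, $\mathcal{N}_l(X)=\mathcal{N}_l(T)$ (unique when it exists). *)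

(* Defs.v *)
From HB Require Import structures.
From mathcomp Require Import all_boot all_order all_algebra.
From mathcomp Require Import ring.
From mathcomp Require Import boolp classical_sets reals.

Set Implicit Arguments.
Unset Strict Implicit.
Unset Printing Implicit Defensive.

Import GRing.Theory.

Local Open Scope ring_scope.
Local Open Scope classical_set_scope.

(* [Quat a b c d] is a + b i + c j + d k. *)
Record quat (R : Type) : Type := Quat { qr : R; qi : R; qj : R; qk : R }.

Section QuatChoice.
Variable R : choiceType.

Definition quat_tuple (x : quat R) : R * R * R * R := (qr x, qi x, qj x, qk x).
Definition tuple_quat (p : R * R * R * R) : quat R :=
  Quat p.1.1.1 p.1.1.2 p.1.2 p.2.

Lemma quat_tupleK : cancel quat_tuple tuple_quat.
Proof. by case. Qed.

HB.instance Definition _ := Choice.copy (quat R) (can_type quat_tupleK).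
End QuatChoice.

Section QuatRing.
Variable R : comNzRingType.
Implicit Types x y z : quat R.

Definition quat0 : quat R := Quat 0 0 0 0.
Definition quat1 : quat R := Quat 1 0 0 0.
Definition quat_opp x := Quat (- qr x) (- qi x) (- qj x) (- qk x).
Definition quat_add x y :=
  Quat (qr x + qr y) (qi x + qi y) (qj x + qj y) (qk x + qk y).
Definition quat_mul x y :=
  Quat (qr x * qr y - qi x * qi y - qj x * qj y - qk x * qk y)
       (qr x * qi y + qi x * qr y + qj x * qk y - qk x * qj y)
       (qr x * qj y - qi x * qk y + qj x * qr y + qk x * qi y)
       (qr x * qk y + qi x * qj y - qj x * qi y + qk x * qr y).

Lemma quat_addA : associative quat_add.
Proof. by move=> [????] [????] [????]; congr Quat; rewrite /= addrA. Qed.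

Lemma quat_addC : commutative quat_add.
Proof. by move=> [????] [????]; congr Quat; rewrite /= addrC. Qed.

Lemma quat_add0 : left_id quat0 quat_add.
Proof. by move=> [????]; congr Quat; rewrite /= add0r. Qed.

Lemma quat_addN : left_inverse quat0 quat_opp quat_add.
Proof. by move=> [????]; congr Quat; rewrite /= addNr. Qed.

HB.instance Definition _ :=
  GRing.isZmodule.Build (quat R) quat_addA quat_addC quat_add0 quat_addN.

Lemma quat_mulA : associative quat_mul.
Proof. by move=> [????] [????] [????]; congr Quat => /=; ring. Qed.

Lemma quat_mul1l : left_id quat1 quat_mul.
Proof. by move=> [????]; congr Quat => /=; ring. Qed.

Lemma quat_mul1r : right_id quat1 quat_mul.
Proof. by move=> [????]; congr Quat => /=; ring. Qed.

Lemma quat_mulDl : left_distributive quat_mul quat_add.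
Proof. by move=> [????] [????] [????]; congr Quat => /=; ring. Qed.

Lemma quat_mulDr : right_distributive quat_mul quat_add.
Proof. by move=> [????] [????] [????]; congr Quat => /=; ring. Qed.

Lemma quat1_neq0 : quat1 != quat0.
Proof. by apply/eqP => -[/eqP]; rewrite oner_eq0. Qed.

HB.instance Definition _ :=
  GRing.Zmodule_isNzRing.Build (quat R)
    quat_mulA quat_mul1l quat_mul1r quat_mulDl quat_mulDr quat1_neq0.
End QuatRing.

(* MathComp's [mxrank], [unitmx] and [invmx] require commutative scalars, so   *)
(* their counterparts are given here over a possibly noncommutative ring.      *)
Section NoncommutativeMatrices.
Variable D : nzRingType.

Definition lrange m n (B : 'M[D]_(m, n)) : set 'rV[D]_n :=
  [set x *m B | x in [set: 'rV[D]_m]].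

Definition lnull m n (B : 'M[D]_(m, n)) : set 'rV[D]_m :=
  [set x | x *m B = 0].

Definition left_free_rows d n (b : 'M[D]_(d, n)) : Prop :=
  forall a : 'rV[D]_d, \sum_(i < d) a 0 i *: row i b = 0 -> a = 0.

(* [V] is the left vector space having the [d] rows of some [b] as a basis. *)
Definition has_ldim n (V : set 'rV[D]_n) (d : nat) : Prop :=
  exists b : 'M[D]_(d, n),
    left_free_rows b /\
    V = [set \sum_(i < d) a 0 i *: row i b | a in [set: 'rV[D]_d]].

(* Scalars multiply the columns of [B] on the right. *)
Definition right_free_cols m n (B : 'M[D]_(m, n)) (J : {set 'I_n}) : Prop :=
  forall c : 'I_n -> D,
    (forall i : 'I_m, \sum_(j in J) B i j * c j = 0) ->
    forall j, j \in J -> c j = 0.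

Definition rcol_rank m n (B : 'M[D]_(m, n)) : nat :=
  (\max_(J : {set 'I_n} | `[< right_free_cols B J >]) #|J|)%N.

Definition full_rank_factorization n m t (W : 'M[D]_(n, m))
    (T : 'M[D]_(n, t)) (S : 'M[D]_(t, m)) : Prop :=
  [/\ rcol_rank W = t, W = T *m S, rcol_rank T = t & rcol_rank S = t].

(* A^(2)_{l,(S,T)} is the unique [X], if any, such that this holds. *)
Definition left_outer_inverse m n p q (A : 'M[D]_(m, n))
    (S : 'M[D]_(p, m)) (T : 'M[D]_(n, q)) (X : 'M[D]_(n, m)) : Prop :=
  [/\ X *m A *m X = X, lrange X = lrange S & lnull X = lnull T].

Definition mx_inverse_of n (M N : 'M[D]_n) : Prop :=
  M *m N = 1%:M /\ N *m M = 1%:M.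

Definition mx_invertible n (M : 'M[D]_n) : Prop := exists N, mx_inverse_of M N.

(* As with [invmx], the value is [M] itself when [M] is not invertible. *)
Definition mx_inv n (M : 'M[D]_n) : 'M[D]_n := xget M [set N | mx_inverse_of M N].
End NoncommutativeMatrices.

(* Main.v *)
(** Full rank makes [T2] left invertible, [H *m T2 = 1], and [S2] right
    invertible, [S2 *m G = 1].  An outer inverse [Y] with the range of [S2] and
    the null space of [T2] then has the form [T2 *m Z *m S2].  In these
    coordinates [Y A Y = Y] reads [Z M Z = Z] with [M = S2 A T2], and equality
    of the ranges (resp. null spaces) lets one cancel [Z] on the left (resp. on
    the right), so [Z] is the inverse of [M]. *)
Require Import Defs.
From mathcomp Require Import all_boot all_order all_algebra.
From mathcomp Require Import boolp classical_sets reals.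
From mathcomp Require Import ring.

Set Implicit Arguments.
Unset Strict Implicit.
Unset Printing Implicit Defensive.

Import GRing.Theory Num.Theory.

Local Open Scope ring_scope.

Definition division_ring (D : nzRingType) : Prop :=
  forall x : D, x != 0 -> exists y, y * x = 1 /\ x * y = 1.

Lemma quat_division_ring (R : realFieldType) : division_ring (quat R).
Proof.
case=> a b c d nz0.
pose N := a ^+ 2 + b ^+ 2 + c ^+ 2 + d ^+ 2.
have N0 : N != 0.
  apply: contraNneq nz0 => /eqP.
  rewrite /N !paddr_eq0 ?addr_ge0 ?sqr_ge0 // !sqrf_eq0.
  by move=> /andP[/andP[/andP[/eqP-> /eqP->] /eqP->] /eqP->].
(* The conjugate divided by the squared norm [N], a sum of squares in an ordered field. *)
exists (Quat (a / N) (- b / N) (- c / N) (- d / N)).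
by split; congr Quat => /=; rewrite /N in N0 *; field.
Qed.

Section DivisionRing.
Variables (D : nzRingType) (divD : division_ring D).

(** Right linear independence of the columns, phrased as injectivity on column vectors. *)
Definition mx_cancel m n (B : 'M[D]_(m, n)) : Prop :=
  forall c : 'cV_n, B *m c = 0 -> c = 0.

(** Induction on the columns: with [L'] a left inverse of the last columns [B'], the projection
    [1 - B' L'] kills [B'] but not the first column [b], which would otherwise be a combination of
    the columns of [B']. *)
Lemma mx_cancel_linv m n (B : 'M[D]_(m, n)) :
  mx_cancel B -> exists L : 'M_(n, m), L *m B = 1%:M.
Proof.
elim: n B => [|n IHn] B Binj.
  by exists 0; apply/matrixP => -[].
pose b : 'cV_m := lsubmx (B : 'M_(m, 1 + n)).
pose B' : 'M_(m, n) := rsubmx (B : 'M_(m, 1 + n)).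
have BE : B = row_mx b B' by rewrite hsubmxK.
have [|L' L'K] := IHn B'.
  move=> c B'c0; have : col_mx (0 : 'cV_1) c = 0.
    by apply: Binj; rewrite BE (mul_row_col b B') mulmx0 add0r.
  by move/(congr1 (@dsubmx _ 1 n 1)); rewrite col_mxKd linear0.
pose v := (1%:M - B' *m L') *m b.
have [i vi0] : exists i, v i 0 != 0.
  apply/existsP; apply: contraT => /existsPn v0.
  have bE : b = B' *m (L' *m b).
    apply/eqP; rewrite -subr_eq0 -[X in X - _]mul1mx mulmxA -mulmxBl.
    apply/eqP/matrixP => i j; rewrite ord1 [RHS]mxE.
    by apply/eqP; move: (v0 i); rewrite negbK.
  have : col_mx (1%:M : 'M_1) (- (L' *m b)) = 0.
    by apply: Binj; rewrite BE (mul_row_col b B') mulmx1 mulmxN -bE subrr.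
  move/(congr1 (@usubmx _ 1 n 1)); rewrite col_mxKu linear0.
  by move/matrixP/(_ 0 0)/eqP; rewrite !mxE oner_eq0.
have [y [yv _]] := divD vi0.
(* A row of the projection, scaled so that [w *m b = 1]. *)
pose w : 'rV_m := (y *: delta_mx 0 i) *m (1%:M - B' *m L').
have wB' : w *m B' = 0.
  by rewrite -mulmxA mulmxBl mul1mx -mulmxA L'K mulmx1 subrr mulmx0.
have wb : w *m b = 1%:M.
  rewrite -mulmxA -/v -scalemxAl -rowE.
  by apply/matrixP => k l; rewrite !ord1 [LHS]mxE [X in _ * X]mxE yv mxE.
clearbody w.
(* The correction makes the lower block kill [b]; it keeps [L' *m B' = 1] because [w *m B' = 0]. *)
exists (col_mx w (L' - L' *m b *m w)).
rewrite BE (mul_col_row w _ b B') wb wB' !mulmxBl L'K -!mulmxA wb wB'.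
rewrite !mulmx0 mulmx1.
by rewrite subrr subr0 (scalar_mx_block 1 n).
Qed.

(** Gaussian elimination: a zero first row is dropped; otherwise restricting to the kernel of that
    row costs one row and one column. *)
Lemma wide_mx_not_cancel m n (B : 'M[D]_(m, n)) : (m < n)%N -> ~ mx_cancel B.
Proof.
elim: m n B => [|m IHm] [|n] B //=; rewrite ?ltnS => le_mn Binj.
  have /matrixP/(_ 0 0)/eqP : const_mx 1 = 0 :> 'cV[D]_n.+1.
    by apply: Binj; apply/matrixP => -[].
  by rewrite !mxE oner_eq0.
pose r : 'rV_n.+1 := usubmx (B : 'M_(1 + m, _)).
pose B' : 'M_(m, n.+1) := dsubmx (B : 'M_(1 + m, _)).
have BE : B = col_mx r B' by rewrite vsubmxK.
have [/existsP[j rj0]|/existsPn r0] := boolP [exists j, r 0 j != 0]; last first.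
  apply: (IHm n.+1 B'); first exact: leqW.
  move=> c B'c0; apply: Binj; rewrite BE (mul_col_mx r B') B'c0.
  suff -> : r = 0 by rewrite mul0mx col_mx0.
  apply/matrixP => i j; rewrite ord1 [RHS]mxE.
  by apply/eqP; move: (r0 j); rewrite negbK.
have [y [_ ry]] := divD rj0.
(* The columns of [K] span the kernel of the pivot row [r]. *)
pose K : 'M_(n.+1, n) := \matrix_(i, k)
  if unlift j i is Some l then (l == k)%:R else - (y * r 0 (lift j k)).
have Kj k : K j k = - (y * r 0 (lift j k)) by rewrite mxE unlift_none.
have Kl l k : K (lift j l) k = (l == k)%:R by rewrite mxE liftK.
have rK : r *m K = 0.
  apply/matrixP => i k; rewrite ord1 [LHS]mxE [RHS]mxE (bigD1_ord j) //= Kj.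
  rewrite mulrN mulrA ry mul1r (bigD1 k) //= Kl eqxx mulr1.
  rewrite big1 ?addr0 ?addNr // => l /negPf lk.
  by rewrite Kl lk mulr0.
apply: (IHm n (B' *m K)) => // c B'Kc0.
have Kc0 : K *m c = 0.
  by apply: Binj; rewrite BE (mul_col_mx r B') !mulmxA rK mul0mx B'Kc0 col_mx0.
(* Away from the pivot index [j], the rows of [K] form the identity, so [K *m c] contains every
   entry of [c]. *)
apply/matrixP => k l; move/matrixP/(_ (lift j k) l): Kc0.
rewrite [LHS]mxE [RHS]mxE [X in _ -> _ = X]mxE (bigD1 k) //= Kl eqxx mul1r.
rewrite big1 ?addr0 // => h; rewrite eq_sym => /negPf hk.
by rewrite Kl hk mul0r.
Qed.

Lemma square_mx_cancel_rinv n (Q : 'M[D]_n) :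
  mx_cancel Q -> exists G, Q *m G = 1%:M.
Proof.
move=> Qinj; have [L LQ] := mx_cancel_linv Qinj; exists L.
have QLid (v : 'cV_n) : Q *m L *m v = v.
  (* If [Q *m L] moved [v], then [v] would lie outside the column span of [Q], and adjoining it
     would give [n + 1] independent columns of height [n]. *)
  apply: contra_notP (@wide_mx_not_cancel n (1 + n) (row_mx v Q) (ltnSn n)).
  move=> QLv c; rewrite -[c]vsubmxK; set u := usubmx c; set w := dsubmx c.
  rewrite mul_row_col => vuQw.
  have [u0|u0] := eqVneq (u 0 0) 0.
    have uz : u = 0 by rewrite [u]mx11_scalar u0 raddf0.
    by move: vuQw; rewrite uz mulmx0 add0r => /Qinj ->; rewrite col_mx0.
  have [y [_ uy]] := divD u0; case: QLv.
  have -> : v = Q *m (- w *m y%:M).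
    rewrite mulmxA mulmxN -(addr0_eq vuQw) opprK.
    by rewrite -mulmxA [u]mx11_scalar -scalar_mxM uy mulmx1.
  by rewrite -!mulmxA (mulmxA L) LQ mul1mx.
apply/matrixP => i j; have /matrixP/(_ i 0) := QLid (col j 1%:M).
by rewrite colEsub mulmx_colsub mulmx1 !mxE.
Qed.

Lemma rcol_rank_colsub m n r (B : 'M[D]_(m, n)) :
  rcol_rank B = r ->
  exists2 f : 'I_r -> 'I_n, injective f & mx_cancel (colsub f B).
Proof.
move=> <-; rewrite /rcol_rank.
have [|J /asboolP Jfree ->] :=
    @eq_bigmax_cond _ (fun J => `[< right_free_cols B J >]) (fun J => #|J|).
  (* The empty set is free, so the maximum defining the rank is attained. *)
  apply/card_gt0P; exists finset.set0.
  by apply/asboolP => c _ j; rewrite finset.inE.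
exists enum_val => [|c Bc0]; first exact: enum_val_inj.
(* Extends [c] by zero outside [J]: the sum has at most one term. *)
pose d j : D := \sum_(k < #|J| | enum_val k == j) c k 0.
have dE k : d (enum_val k) = c k 0.
  rewrite /d (big_pred1 k) // => l; exact: inj_eq enum_val_inj _ _.
apply/matrixP => k l; rewrite ord1 -dE [RHS]mxE.
apply: Jfree (enum_valP k) => i.
rewrite big_enum_val /=; move/matrixP/(_ i 0): Bc0; rewrite !mxE => Bc0.
rewrite -[RHS]Bc0; by apply: eq_bigr => h _; rewrite mxE dE.
Qed.

(** The [n] independent columns are all the columns up to a permutation. *)
Lemma rcol_rank_linv m n (B : 'M[D]_(m, n)) :
  rcol_rank B = n -> exists L : 'M_(n, m), L *m B = 1%:M.
Proof.
move=> /rcol_rank_colsub[f finj fB]; apply: mx_cancel_linv => c Bc0.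
have [g fK gK] := injF_bij finj.
have /matrixP fc0 : rowsub f c = 0.
  apply: fB; rewrite -[RHS]Bc0; apply/matrixP => i j.
  rewrite !mxE [RHS](reindex f) /=; last by exists g => k _.
  by apply: eq_bigr => k _; rewrite !mxE.
by apply/matrixP => i j; move: (fc0 (g i) j); rewrite !mxE gK.
Qed.

(** The [m] independent columns form an invertible square block; its inverse, padded with zero rows,
    is a right inverse. No comparison of row and column rank enters. *)
Lemma rcol_rank_rinv m n (B : 'M[D]_(m, n)) :
  rcol_rank B = m -> exists G : 'M_(n, m), B *m G = 1%:M.
Proof.
move=> /rcol_rank_colsub[f _ /square_mx_cancel_rinv[G BG]].
by exists (colsub f 1%:M *m G); rewrite mulmxA mulmx_colsub mulmx1.
Qed.

End DivisionRing.

Section RangeNull.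
Variable D : nzRingType.
Local Open Scope classical_set_scope.

Lemma lrange_subP p m n (B : 'M[D]_(m, n)) (C : 'M[D]_(p, n)) :
  lrange B `<=` lrange C <-> exists V, B = V *m C.
Proof.
split=> [BC|[V ->] _ [x _ <-]]; last by exists (x *m V); rewrite ?mulmxA.
have rowP i : exists x, x *m C = row i B.
  have [|x _ xE] := BC (row i B); last by exists x.
  by exists (delta_mx 0 i); rewrite -?rowE.
have [x xE] := choice rowP.
by exists (\matrix_i x i); apply/row_matrixP => i; rewrite row_mul rowK xE.
Qed.

(** Passes from single rows to matrices [x], so that null space inclusions apply to matrix
    identities. *)
Lemma lnull_subP p m n (B : 'M[D]_(m, n)) (C : 'M[D]_(m, p)) :
  lnull B `<=` lnull C <->
  forall k (x : 'M_(k, m)), x *m B = 0 -> x *m C = 0.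
Proof.
split=> [BC k x xB0|BC x]; last exact: BC.
apply/row_matrixP => i; rewrite row_mul row0; apply: BC.
by rewrite /lnull /= -row_mul xB0 row0.
Qed.

Lemma lrange_mull m n t (T : 'M[D]_(n, t)) (S : 'M[D]_(t, m)) L :
  L *m T = 1%:M -> lrange (T *m S) = lrange S.
Proof.
move=> LT; apply/seteqP; split; apply/lrange_subP; first by exists T.
by exists L; rewrite mulmxA LT mul1mx.
Qed.

Lemma lnull_mulr m n t (T : 'M[D]_(n, t)) (S : 'M[D]_(t, m)) G :
  S *m G = 1%:M -> lnull (T *m S) = lnull T.
Proof.
move=> SG; apply/seteqP; split; apply/lnull_subP => k x; rewrite !mulmxA.
  by move=> xTS0; rewrite -[x *m T]mulmx1 -SG mulmxA xTS0 mul0mx.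
by move->; rewrite mul0mx.
Qed.

Lemma mx_inverse_of_unique n (M N N' : 'M[D]_n) :
  mx_inverse_of M N -> mx_inverse_of M N' -> N = N'.
Proof.
by move=> [_ NM] [MN' _]; rewrite -[N]mulmx1 -MN' mulmxA NM mul1mx.
Qed.

Lemma mx_inv_unique n (M N : 'M[D]_n) : mx_inverse_of M N -> mx_inv M = N.
Proof.
by move=> MN; apply: xget_unique => // N' /mx_inverse_of_unique; apply.
Qed.

Lemma left_outer_inverseE m n t (A : 'M[D]_(m, n)) (T : 'M[D]_(n, t))
    (S : 'M[D]_(t, m)) H G Y :
  H *m T = 1%:M -> S *m G = 1%:M -> left_outer_inverse A S T Y ->
  exists2 Z, mx_inverse_of (S *m A *m T) Z & Y = T *m Z *m S.
Proof.
move=> HT SG [YAY /seteqP[rYS rSY] /seteqP[nYT nTY]].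
have /lrange_subP[U YU] := rYS; have /lrange_subP[V SV] := rSY.
pose Z := H *m Y *m G.
have YE : Y = T *m Z *m S.
  have -> : Y = Y *m G *m S by rewrite {2}YU -(mulmxA U) SG mulmx1.
  (* [1 - T H] annihilates [T], hence also [Y], which gives [Y = T H Y]. *)
  rewrite /Z !mulmxA; congr (_ *m _ *m _); apply/eqP.
  rewrite -subr_eq0 -[X in X - _]mul1mx -mulmxBl; apply/eqP.
  apply: (lnull_subP _ _).1 nTY _ _ _.
  by rewrite mulmxBl mul1mx -mulmxA HT mulmx1 subrr.
clearbody Z.
(* From [S = V Y = V T Z S], cancelling [S] by [G]. *)
have VTZ : V *m T *m Z = 1%:M.
  by rewrite -[LHS]mulmx1 -SG mulmxA -(mulmxA V T) -(mulmxA V) -YE -SV.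
have Zcancel k (x : 'M_(k, t)) : x *m Z = 0 -> x = 0.
  move=> xZ0; rewrite -[x]mulmx1 -HT mulmxA.
  apply: (lnull_subP _ _).1 nYT _ _ _.
  by rewrite YE !mulmxA -(mulmxA x H) HT mulmx1 xZ0 mul0mx.
have ZMZ : Z *m (S *m A *m T) *m Z = Z.
  have /(congr1 (fun B => H *m B *m G)) := YAY; rewrite YE.
  by rewrite !mulmxA HT mul1mx -!(mulmxA _ S G) SG !mulmx1.
exists Z => //; split.
  (* With [M = S A T]: [M Z = V T (Z M Z) = V T Z = 1]. *)
  by rewrite -[LHS]mul1mx -VTZ -!(mulmxA V) -!(mulmxA T) (mulmxA Z) ZMZ.
apply/eqP; rewrite -subr_eq0; apply/eqP/Zcancel.
by rewrite mulmxBl mul1mx ZMZ subrr.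
Qed.

End RangeNull.

Theorem theorem4p12 (R : realType) (m n nu t : nat)
    (A : 'M[quat R]_(m, n)) (W2 : 'M[quat R]_(n, m))
    (T2 : 'M[quat R]_(n, t)) (S2 : 'M[quat R]_(t, m))
    (hA : rcol_rank A = nu)
    (hR : has_ldim (lrange W2) t)
    (ht : (t <= nu)%N)
    (hN : has_ldim (lnull W2) (n - t)%N)
    (hW : full_rank_factorization W2 T2 S2)
    (hex : exists Y : 'M[quat R]_(n, m), left_outer_inverse A W2 W2 Y) :
  mx_invertible (S2 *m A *m T2) /\
  let X := T2 *m mx_inv (S2 *m A *m T2) *m S2 in
  unique (left_outer_inverse A W2 W2) X /\
  unique (left_outer_inverse A S2 T2) X.
Proof.
have [_ WE rT rS] := hW; have divH := @quat_division_ring R.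
have [H HT] := rcol_rank_linv divH rT.
have [G SG] := rcol_rank_rinv divH rS.
(* [W2] has the left range of [S2] and the left null space of [T2], so both claims concern the same
   outer inverse. *)
have -> : left_outer_inverse A W2 W2 = left_outer_inverse A S2 T2.
  apply/funext => Y; rewrite /left_outer_inverse WE.
  by rewrite (lrange_mull _ HT) (lnull_mulr _ SG).
have {hex} [Y YP] : exists Y, left_outer_inverse A S2 T2 Y.
  have [Y] := hex; rewrite /left_outer_inverse WE.
  by rewrite (lrange_mull _ HT) (lnull_mulr _ SG); exists Y.
(* This yields uniqueness, and applied to the given [Y] it also shows that the formula is an outer
   inverse. *)
have XE Y' : left_outer_inverse A S2 T2 Y' ->
    T2 *m mx_inv (S2 *m A *m T2) *m S2 = Y'.
  by move=> /(left_outer_inverseE HT SG)[Z /mx_inv_unique-> ->].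
have [Z MZ _] := left_outer_inverseE HT SG YP.
split; first by exists Z.
by split; split=> //; rewrite (XE Y YP).
Qed.
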